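(* Let $T_2,T_3\in \mathcal{L}_A(\mathcal{H})$. Then $$w_{\mathbb{A}}\left(\begin{bmatrix} 0 & T_2\\ T_3 & 0\end{bmatrix}\right)\geq \max\left\{w_A(T_2), w_A(T_3)\right\}-\min\left\{\frac{\|T_2+T_3\|_A}{2}, \frac{\|T_2-T_3\|_A}{2}\right\}$$ and $$w_{\mathbb{A}}\left(\begin{bmatrix} 0 & T_2\\ T_3 & 0\end{bmatrix}\right)\geq \max\left\{\frac{\|T_2+T_3\|_A}{2}, \frac{\|T_2-T_3\|_A}{2}\right\}-\min\left\{w_A(T_2), w_A(T_3)\right\}.$$
   Context: $\mathcal{H}$ is a complex Hilbert space with inner product $\langle\cdot,\cdot\rangle$, and $\mathcal{L}(\mathcal{H})$ is the algebra of bounded linear operators on $\mathcal{H}$. $A\in\mathcal{L}(\mathcal{H})$ is a fixed positive operator, i.e. $A=A^*$ and $\langle Ax,x\rangle\ge 0$ for all $x\in\mathcal{H}$ ($A$ need not be injective). Put $\langle x,y\rangle_A=\langle Ax,y\rangle$ and $\|x\|_A=\sqrt{\langle x,x\rangle_A}$ (a seminorm). $\mathcal{R}(\cdot)$ denotes the range, and $\mathcal{L}_A(\mathcal{H})=\{T\in\mathcal{L}(\mathcal{H}):\mathcal{R}(T^*A)\subseteq\mathcal{R}(A)\}$ (the operators admitting an $A$-adjoint, i.e. an $X\in\mathcal{L}(\mathcal{H})$ with $AX=T^*A$). For $T\in\mathcal{L}_A(\mathcal{H})$ the $A$-operator seminorm is $\|T\|_A=\sup\{\|Tx\|_A/\|x\|_A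 : x\in\overline{\mathcal{R}(A)},\ x\ne 0\}$, and the $A$-numerical radius is $w_A(T)=\sup\{|\langle Tx,x\rangle_A| : x\in\mathcal{H},\ \|x\|_A=1\}$. $\mathbb{A}=\begin{bmatrix} A&0\\0&A\end{bmatrix}$ is the positive diagonal operator on $\mathcal{H}\oplus\mathcal{H}$, and $w_{\mathbb{A}}$ is the numerical radius defined in the same way with $(\mathcal{H}\oplus\mathcal{H},\mathbb{A})$ in place of $(\mathcal{H},A)$. *)

(* Defs.v *)
From HB Require Import structures.
From mathcomp Require Import all_boot all_order all_algebra.
From mathcomp Require Import complex.
From mathcomp Require Import all_classical all_reals all_analysis.

Set Implicit Arguments.
Unset Strict Implicit.
Unset Printing Implicit Defensive.

Import Order.TTheory GRing.Theory Num.Theory.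

Local Open Scope classical_set_scope.
Local Open Scope ring_scope.

(* Inner products are linear in the first argument and conjugate-linear in the
   second.  All suprema are suprema of sets of real numbers, with
   sup set0 = 0. *)

Section InnerProduct.
Context {R : realType} {V : lmodType R[i]} (inner : {dot V for Num.conj}).

Definition adjoint_of (T S : V -> V) : Prop :=
  forall x y, inner (T x) y = inner x (S y).

(* T^*: an adjoint is unique because inner is positive definite, and it exists
   for every bounded T on a Hilbert space; the default value only concerns
   functions that have no adjoint. *)
Definition adjoint (T : V -> V) : V -> V := xget (fun=> 0) (adjoint_of T).

Definition positive_op (A : V -> V) : Prop :=
  adjoint A = A /\ forall x, 0 <= inner (A x) x.

Definition inner_wrt (A : V -> V) (x y : V) : R[i] := inner (A x) y.

(* For positive A, inner_wrt A x x is real and nonnegative, so that taking its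
   real part only changes the type. *)
Definition seminorm_wrt (A : V -> V) (x : V) : R :=
  Num.sqrt (complex.Re (inner_wrt A x x)).

(* For z : R[i], `|z| : R[i] is real. *)
Definition num_radius (A T : V -> V) : R :=
  sup [set complex.Re `|inner_wrt A (T x) x| | x in
        [set x | seminorm_wrt A x = 1]].

End InnerProduct.

Section Operators.
Context {R : realType} {H : normedModType R[i]} (inner : {dot H for Num.conj}).

Definition in_LA (A T : H -> H) : Prop :=
  continuous T /\ range (adjoint inner T \o A) `<=` range A.

Definition op_seminorm (A T : H -> H) : R :=
  sup [set seminorm_wrt inner A (T x) / seminorm_wrt inner A x | x in
        [set x | closure (range A) x /\ x != 0]].

End Operators.

Section DirectSum.
Context {R : realType} {V : lmodType R[i]} (inner : {dot V for Num.conj}).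

(* The inner product of the Hilbert direct sum.  The library norm on V * V is
   the maximum norm, which is equivalent to the norm of this inner product;
   num_radius depends on the inner product only. *)
Definition sum_inner (x y : V * V) : R[i] := inner x.1 y.1 + inner x.2 y.2.

Let sum_inner_linearl y : linear_for *%R (sum_inner ^~ y).
Proof.
move=> a u v; rewrite /sum_inner /= !linearPl /=.
by rewrite mulrDr addrACA.
Qed.

Let sum_inner_linearr x : linear_for (Num.conj \; *%R) (sum_inner x).
Proof.
move=> a u v; rewrite /sum_inner /= !linearPr /=.
by rewrite mulrDr addrACA.
Qed.

HB.instance Definition _ :=
  bilinear_isBilinear.Build R[i] (V * V)%type (V * V)%type R[i] *%R
    (Num.conj \; *%R) sum_inner (sum_inner_linearl, sum_inner_linearr).

Let sum_inner_herm x y : sum_inner x y = (-1) ^+ false * (sum_inner y x)^*.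
Proof.
by rewrite /sum_inner hermC /= [inner x.2 _]hermC /= !expr0 !mul1r rmorphD.
Qed.

HB.instance Definition _ :=
  isHermitianSesquilinear.Build R[i] (V * V)%type false Num.conj sum_inner
    sum_inner_herm.

Let sum_inner_gt0 x : x != 0 -> 0 < sum_inner x x.
Proof.
case: x => x1 x2; rewrite /sum_inner /= -pair_eqE negb_and.
by case/orP => ?; [apply: ltr_pwDl|apply: ltr_wpDl]; rewrite ?dnorm_gt0 ?dnorm_ge0.
Qed.

HB.instance Definition _ :=
  isDotProduct.Build R[i] (V * V)%type sum_inner sum_inner_gt0.

End DirectSum.

Definition block_op {V : zmodType} (T11 T12 T21 T22 : V -> V) (x : V * V) :
    V * V :=
  (T11 x.1 + T12 x.2, T21 x.1 + T22 x.2).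

(* Main.v *)
(** Write |x|_A for the seminorm of A.  Polarization reduces everything to two
bounds on the form <., .>_A.  Evaluating the block operator at (x, y) and at
(x, iy) gives |<T2 y, x>_A +- <T3 x, y>_A| <= w (|x|_A^2 + |y|_A^2), w its
numerical radius; evaluating T at x +- iy gives
|<T x, y>_A - <T y, x>_A| <= w_A(T) (|x|_A^2 + |y|_A^2).  The first inequality
uses the former with x = y, the second adds the two.

All suprema must be finite, that is, every T in L_A must be bounded for |.|_A.
The inclusion of the range of T^*A in the range of A makes
{A T x : |A x| <= 1} weakly bounded, so that |A T x| <= C |A x|.  Choose S x
with A (S x) = T^* A T x; then S is symmetric for <., .>_A and
|A (S^n x)| <= D^n |A x|, so |S^n x|_A = O(D^n).  As
|S^n x|_A^2 <= |x|_A |S^2n x|_A, this forces |S x|_A <= D |x|_A (Krein's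
argument) and bounds |T x|_A^2 = <S x, x>_A. *)

Require Import Defs.
From HB Require Import structures.
From mathcomp Require Import all_boot all_order all_algebra.
From mathcomp Require Import complex.
From mathcomp Require Import all_classical all_reals all_analysis.
From mathcomp Require Import ring lra.

Set Implicit Arguments.
Unset Strict Implicit.
Unset Printing Implicit Defensive.

Import Order.TTheory GRing.Theory Num.Theory.
Import numFieldNormedType.Exports.

Local Open Scope classical_set_scope.
Local Open Scope ring_scope.

(** * Positive semidefinite sesquilinear forms *)

Section Modulus.
Context {R : realType}.
Implicit Types (z : R[i]) (r : R).

(** The norm on [R[i]] takes its values in [R[i]]. A real-valued modulus keeps all estimates in [R],
    where [lra] and [nra] apply. *)
Definition cmod z : R := complex.Re `|z|.

Lemma cmodE z : `|z| = (cmod z)%:C%C.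
Proof. by rewrite /cmod normc_def. Qed.

Lemma cmod_ge0 z : 0 <= cmod z.
Proof. by rewrite -ler0c -cmodE. Qed.

Lemma cmodD z1 z2 : cmod (z1 + z2) <= cmod z1 + cmod z2.
Proof. by rewrite -lecR rmorphD /= -!cmodE ler_normD. Qed.

Lemma cmodM z1 z2 : cmod (z1 * z2) = cmod z1 * cmod z2.
Proof. by apply: complexI; rewrite rmorphM /= -!cmodE normrM. Qed.

Lemma cmodN z : cmod (- z) = cmod z.
Proof. by rewrite /cmod normrN. Qed.

Lemma cmodB z1 z2 : cmod (z1 - z2) <= cmod z1 + cmod z2.
Proof. by rewrite -(cmodN z2) cmodD. Qed.

Lemma cmod_conj z : cmod z^* = cmod z.
Proof. by rewrite /cmod norm_conjC. Qed.

Lemma cmod_real r : cmod r%:C%C = `|r|.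
Proof. by rewrite /cmod normc_def /= expr0n addr0 sqrtr_sqr. Qed.

Lemma cmod_eq0 z : cmod z = 0 -> z = 0.
Proof. by move=> z0; apply/eqP; rewrite -normr_eq0 cmodE z0. Qed.

Lemma cmod_gt0 z : (0 < cmod z) = (z != 0).
Proof. by rewrite -normr_gt0 cmodE -(rmorph0 (real_complex R)) ltcR. Qed.

Lemma cmod1 : cmod 1 = 1.
Proof. by rewrite /cmod normr1. Qed.

Lemma cmod_i : cmod 'i%C = 1.
Proof. by rewrite /cmod normc_def /= expr0n expr1n add0r sqrtr1. Qed.

Lemma conj_i : ('i%C : R[i])^* = - 'i%C.
Proof. by apply/eqP; rewrite eq_complex /= oppr0 !eqxx. Qed.

Lemma cmodX2 z : z * z^* = (cmod z ^+ 2)%:C%C.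
Proof. by rewrite -normCK cmodE rmorphXn. Qed.

Lemma Re_le_cmod z : complex.Re z <= cmod z.
Proof.
rewrite /cmod normc_def /= (le_trans (ler_norm _))// -sqrtr_sqr ler_wsqrtr//.
by rewrite lerDl sqr_ge0.
Qed.

End Modulus.

Section PositiveForms.
Context {R : realType} {V : lmodType R[i]}.
Implicit Types (b : V -> V -> R[i]) (x y : V).

(** A predicate on plain functions, so that the same lemmas serve [inner], the possibly degenerate
    [inner_wrt inner A], and the form on the direct sum. *)
Definition psd_form b : Prop :=
  [/\ forall a u v w, b (a *: u + v) w = a * b u w + b v w,
      forall u v, b u v = (b v u)^* &
      forall u, 0 <= b u u].

Definition fnorm b x : R := Num.sqrt (complex.Re (b x x)).

Lemma fnorm_ge0 b x : 0 <= fnorm b x.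
Proof. exact: sqrtr_ge0. Qed.

Context (b : V -> V -> R[i]) (b_psd : psd_form b).
Let N := fnorm b.

Lemma form0l y : b 0 y = 0.
Proof.
have [lin _ _] := b_psd; have := lin 1 0 0 y.
rewrite scale1r mul1r addr0 => /eqP.
by rewrite -subr_eq subrr eq_sym => /eqP.
Qed.

Lemma formDl u v y : b (u + v) y = b u y + b v y.
Proof. by have [lin _ _] := b_psd; rewrite -{1}(scale1r u) lin mul1r. Qed.

Lemma formZl a u y : b (a *: u) y = a * b u y.
Proof.
by have [lin _ _] := b_psd; rewrite -(addr0 (_ *: _)) lin form0l addr0.
Qed.

Lemma formC x y : b x y = (b y x)^*.
Proof. by have [_ + _] := b_psd; apply. Qed.

Lemma form0r y : b y 0 = 0.
Proof. by rewrite formC form0l conjC0. Qed.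

Lemma formDr u v y : b y (u + v) = b y u + b y v.
Proof. by rewrite formC formDl rmorphD /= -!formC. Qed.

Lemma formZr a u y : b y (a *: u) = a^* * b y u.
Proof. by rewrite formC formZl rmorphM /= -formC. Qed.

Lemma formNl u y : b (- u) y = - b u y.
Proof. by rewrite -scaleN1r formZl mulN1r. Qed.

Lemma formNr u y : b y (- u) = - b y u.
Proof. by rewrite formC formNl rmorphN /= -formC. Qed.

Lemma formBl u v y : b (u - v) y = b u y - b v y.
Proof. by rewrite formDl formNl. Qed.

Lemma form_norm x : b x x = (N x ^+ 2)%:C%C.
Proof.
have [_ _ /(_ x) x0] := b_psd.
rewrite sqr_sqrtr; last by move: x0; rewrite lecE => /andP[].
by rewrite RRe_real// ger0_real.
Qed.

Lemma fnorm0 : N 0 = 0.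
Proof. by rewrite /N /fnorm form0l sqrtr0. Qed.

Lemma fnormZ a x : N (a *: x) = cmod a * N x.
Proof.
apply/eqP; rewrite -(@eqrXn2 _ 2)// ?mulr_ge0 ?fnorm_ge0 ?cmod_ge0//.
apply/eqP/(@complexI R).
by rewrite exprMn [in RHS]rmorphM /= -!form_norm formZl formZr mulrA cmodX2.
Qed.

Lemma fnormN x : N (- x) = N x.
Proof.
by rewrite -scaleN1r fnormZ cmodN cmod1 mul1r.
Qed.

Lemma fnorm_sub x y : N (x - y) = N (y - x).
Proof. by rewrite -fnormN opprB. Qed.

Lemma fnormD2 x y :
  N (x + y) ^+ 2 = N x ^+ 2 + 2 * complex.Re (b x y) + N y ^+ 2.
Proof.
apply: (@complexI R); rewrite -form_norm formDl !formDr !form_norm.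
rewrite [b y x]formC.
by case: (b x y) => u v; apply/eqP; rewrite eq_complex /=; apply/andP; split;
  apply/eqP; ring.
Qed.

Lemma fnorm_parallelogram x y :
  N (x + y) ^+ 2 + N (x - y) ^+ 2 = 2 * N x ^+ 2 + 2 * N y ^+ 2.
Proof.
rewrite !fnormD2 fnormN formNr raddfN /=; ring.
Qed.

(** The factor [b x y] turns the cross term into a real multiple of its squared modulus, leaving a
    real quadratic polynomial in [r]. *)
Lemma fnorm_quadratic r x y :
  N (x - (r%:C%C * b x y) *: y) ^+ 2 =
  N x ^+ 2 - 2 * r * cmod (b x y) ^+ 2 + r ^+ 2 * cmod (b x y) ^+ 2 * N y ^+ 2.
Proof.
rewrite fnormD2 fnormN fnormZ formNr formZr rmorphM /= mulrAC.
rewrite -mulrA cmodX2 cmodM cmod_real !exprMn real_normK ?num_real//.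
have -> : (r%:C%C)^* = r%:C%C by exact: conjc_real.
by rewrite -rmorphM -rmorphN /=; ring.
Qed.

Lemma cauchy_schwarz x y : cmod (b x y) <= N x * N y.
Proof.
rewrite -(@ler_pXn2r _ 2)// ?nnegrE ?mulr_ge0 ?fnorm_ge0 ?cmod_ge0//.
rewrite exprMn; set m := cmod _ ^+ 2.
have m0 : 0 <= m by rewrite sqr_ge0.
have h r : 0 <= N x ^+ 2 - 2 * r * m + r ^+ 2 * m * N y ^+ 2.
  by rewrite -fnorm_quadratic sqr_ge0.
(* The form may vanish at [y]. The polynomial is then affine in [r], and the value of [r] below
   would make it equal to [- N x ^+ 2 - 2]. *)
have [c0|c0] := eqVneq (N y ^+ 2) 0.
  rewrite c0 mulr0 leNgt; apply/negP => mp.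
  have := h ((N x ^+ 2 + 1) / m); rewrite c0 mulr0 addr0.
  rewrite mulrA mulfVK ?gt_eqF//; have := sqr_ge0 (N x); lra.
have cp : 0 < N y ^+ 2 by rewrite lt0r c0 sqr_ge0.
(* The polynomial is taken at its minimizer, the inverse of [N y ^+ 2]. *)
rewrite -subr_ge0 (_ : _ - m =
  (N x ^+ 2 - 2 * (N y ^+ 2)^-1 * m + (N y ^+ 2)^-1 ^+ 2 * m * N y ^+ 2) *
  N y ^+ 2).
  by rewrite mulr_ge0 ?sqr_ge0 ?h.
by field; move: c0; rewrite sqrf_eq0.
Qed.

Lemma fnormD x y : N (x + y) <= N x + N y.
Proof.
rewrite -(@ler_pXn2r _ 2)// ?nnegrE ?addr_ge0 ?fnorm_ge0// fnormD2.
have := cauchy_schwarz x y; have := Re_le_cmod (b x y); nra.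
Qed.

Lemma fnormB x y : N (x - y) <= N x + N y.
Proof. by rewrite -(fnormN y) fnormD. Qed.

Lemma fnorm_eq0_form x y : N x = 0 -> b x y = 0.
Proof.
move=> x0; apply: cmod_eq0; apply/eqP; rewrite eq_le cmod_ge0 andbT.
by rewrite (le_trans (cauchy_schwarz _ _))// x0 mul0r.
Qed.

Lemma fnormD_null x y : N y = 0 -> N (x + y) = N x.
Proof.
move=> y0; apply/eqP; rewrite eq_le; apply/andP; split.
  by rewrite (le_trans (fnormD _ _))// y0 addr0.
by rewrite -{1}(addrK y x) (le_trans (fnormB _ _))// y0 addr0.
Qed.

End PositiveForms.

(** * Projection, Riesz representation and uniform boundedness *)

Section HilbertSpace.
Context {R : realType} {H : completeNormedModType R[i]}.
Context (inner : {dot H for Num.conj}).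
Hypothesis norm_inner : forall x : H, `|x| ^+ 2 = inner x x.
Local Notation N := (fnorm inner).

Lemma inner_psd : psd_form inner.
Proof.
split=> [a u v w|u v|u].
- by rewrite linearPl.
- by rewrite hermC /= expr0 mul1r.
- exact: dnorm_ge0.
Qed.
Let ip := inner_psd.

Lemma normE x : `|x| = (N x)%:C%C.
Proof.
apply/eqP; rewrite -(@eqrXn2 _ 2)// ?ler0c ?fnorm_ge0// norm_inner.
by rewrite (form_norm ip) rmorphXn.
Qed.

Lemma gt0_complex (e : R[i]) : 0 < e -> exists2 r : R, 0 < r & e = r%:C%C.
Proof.
move=> e0; exists (complex.Re e); last by rewrite RRe_real// gtr0_real.
by move: e0; rewrite ltcE => /andP[].
Qed.

(** Completeness with an explicit rate: the limit inherits the bound [e n], on comparing it with a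
    term of index at least [n] that is close to it. *)
Lemma fnorm_complete (u : nat -> H) (e : nat -> R) :
  (forall n m, (n <= m)%N -> N (u m - u n) <= e n) ->
  (forall d, 0 < d -> exists n, e n < d) ->
  exists x, forall n, N (x - u n) <= e n.
Proof.
move=> ue e0.
have /cauchy_cvg/cvg_ex[/= x ux] : cauchy (u @ \oo).
  apply: cauchy_exP => _ /gt0_complex[d d0 ->].
  have [n nd] := e0 _ d0; exists (u n); exists n => //= m nm.
  rewrite -ball_normE /ball_/= normE ltcR (fnorm_sub ip).
  exact: le_lt_trans (ue _ _ nm) nd.
exists x => n; apply/ler_addgt0Pr => d d0.
have dC : 0 < d%:C%C by rewrite -(rmorph0 (real_complex R)) ltcR.
have [m _ um] := (cvg_ballP _ _).1 ux _ dC.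
have /um : (m <= maxn n m)%N by rewrite leq_maxr.
rewrite /= -ball_normE /ball_/= normE ltcR => uxd.
rewrite -(subrKA (u (maxn n m))) (le_trans (fnormD ip _ _))// addrC lerD//.
  by apply: ue; rewrite leq_maxl.
exact: ltW.
Qed.

Lemma closure_fnorm (A : set H) x :
  (forall e, 0 < e -> exists2 y, A y & N (x - y) < e) -> closure A x.
Proof.
move=> h B /nbhs_ballP[_ /= /gt0_complex[d d0 ->]] dB.
have [y Ay xy] := h _ d0; exists y; split=> //; apply: dB.
by rewrite -ball_normE /ball_/= normE ltcR.
Qed.

Lemma continuous_fnorm_bounded (T : {linear H -> H}) : continuous T ->
  exists2 c, 0 < c & forall x, N (T x) <= c * N x.
Proof.
move=> /linear_bounded_continuous/linear_boundedP/pinfty_ex_gt0.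
move=> [_ /gt0_complex[c c0 ->]] cT; exists c => // x.
by rewrite -lecR rmorphM /= -!normE cT.
Qed.

(** By the parallelogram law a minimizing sequence for the distance to [M] is Cauchy. Its limit [p]
    lies in the closure of the subspace [M], expressed by approximation. *)
Lemma orthogonal_projection (M : set H) : M 0 ->
  (forall a u v, M u -> M v -> M (a *: u + v)) ->
  forall x, exists2 p, (forall e, 0 < e -> exists2 m, M m & N (p - m) < e) &
    forall m, M m -> inner (x - p) m = 0.
Proof.
move=> M0 Mlin x; set E := [set N (x - m) | m in M]; set d := inf E.
have Einf : has_inf E.
  split; first by exists (N (x - 0)); exists 0.
  by exists 0 => _ [m _ <-]; exact: fnorm_ge0.
have d_le m : M m -> d <= N (x - m).
  by move=> Mm; apply: ge_inf; [case: Einf|exists m].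
have d0 : 0 <= d.
  by apply: lb_le_inf; [case: Einf|move=> _ [m _ <-]; exact: fnorm_ge0].
have [t [t01 tmono tsmall]] : exists t : nat -> R,
    [/\ forall n, 0 < t n <= 1, forall n m, (n <= m)%N -> t m <= t n &
      forall c eps, 0 < eps -> exists n, c * t n < eps].
  exists (fun n => n.+1%:R^-1); split=> [n|n m nm|c eps eps0].
  - by rewrite invr_gt0 ltr0n invf_le1 ?ltr0n// ler1n.
  - by rewrite lef_pV2 ?posrE ?ltr0n// ler_nat.
  exists (Num.truncn (c / eps)).
  by rewrite ltr_pdivrMr ?ltr0n// mulrC -ltr_pdivrMr// truncnS_gt.
have /choice[u ud] (n : nat) : exists m, M m /\ N (x - m) < d + t n.
  have /andP[tn0 _] := t01 n.
  by have [_ [m Mm <-] md] := inf_adherent tn0 Einf; exists m.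
(* The parallelogram law will bound the square of [N (u m - u n)] by [4 (d + t n)^2 - 4 d^2], which
   is at most [(8 d + 4) t n] because [t n <= 1]. *)
pose e (n : nat) : R := Num.sqrt ((8 * d + 4) * t n).
have e_ge0 n : 0 <= e n by exact: sqrtr_ge0.
have e2 n : e n ^+ 2 = (8 * d + 4) * t n.
  by have := t01 n => /andP[/ltW tn _]; rewrite sqr_sqrtr// mulr_ge0//; lra.
have esmall eps : 0 < eps -> exists2 n, e n < eps & t n < eps.
  move=> eps0; have eps1 : 0 < Num.min (eps ^+ 2) eps.
    by rewrite lt_min eps0 exprn_gt0.
  have [n] := tsmall (8 * d + 4) _ eps1.
  rewrite lt_min -e2 => /andP[en tn]; exists n.
    by rewrite -(@ltr_pXn2r _ 2)// ?nnegrE// ltW.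
  have /andP[tn0 _] := t01 n; apply: le_lt_trans tn.
  by rewrite e2 ler_peMl ?ltW//; lra.
have [p pu] : exists p, forall n, N (p - u n) <= e n.
  apply: fnorm_complete => [n m nm|eps /esmall[n en _]]; last by exists n.
  rewrite -(@ler_pXn2r _ 2)// ?nnegrE ?fnorm_ge0// e2.
  have [Mn un] := ud n; have [Mm um] := ud m.
  have := fnorm_parallelogram ip (x - u n) (x - u m).
  rewrite (_ : x - u n - (x - u m) = u m - u n); last first.
    by rewrite opprB addrC addrA subrK.
  (* The midpoint lies in [M], so the sum of the two differences has norm at least [2 d]. *)
  have /d_le : M (2^-1 *: u n + 2^-1 *: u m).
    by apply: (Mlin) => //; rewrite -(addr0 (_ *: _)); exact: Mlin.
  have -> : x - (2^-1 *: u n + 2^-1 *: u m) =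
      (2^-1 : R)%:C%C *: (x - u n + (x - u m)).
    rewrite (_ : (2^-1 : R)%:C%C = 2^-1); last by rewrite fmorphV rmorph_nat.
    rewrite addrACA -opprD scalerBr scalerDr; congr (_ - _).
      rewrite -scalerDl -mulr2n -[_ *+ 2]mulr_natr.
      by rewrite mulVf ?scale1r// pnatr_eq0.
    by rewrite scalerDr.
  rewrite (fnormZ ip) cmod_real ger0_norm ?invr_ge0//.
  move: (tmono _ _ nm) un um.
  move: (fnorm_ge0 inner (x - u n)) (fnorm_ge0 inner (x - u m)).
  move: (N (x - u n)) (N (x - u m)) (N (x - u n + _)) (N (u m - u n)).
  move=> a1 a2 a3 a4 a10 a20 tnm h1 h2 h3 h4.
  have /andP[tn0 tn1] := t01 n.
  have h5 : a1 ^+ 2 <= (d + t n) ^+ 2 by rewrite lerXn2r ?nnegrE//; lra.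
  have h6 : a2 ^+ 2 <= (d + t n) ^+ 2 by rewrite lerXn2r ?nnegrE//; lra.
  have h7 : (2 * d) ^+ 2 <= a3 ^+ 2 by rewrite lerXn2r ?nnegrE//; lra.
  nra.
exists p => [eps /esmall[n en _]|m Mm].
  by exists (u n); [case: (ud n)|exact: le_lt_trans en].
have zd : N (x - p) <= d.
  apply/ler_addgt0Pr => eps eps0.
  have [n en ne] := esmall (eps / 2) ltac:(lra).
  have [_ un] := ud n; have := pu n.
  have := fnormB ip (x - u n) (p - u n); rewrite opprB addrA subrK.
  lra.
have dz v : M v -> d <= N (x - p - v).
  move=> Mv; apply/ler_addgt0Pr => eps eps0.
  have [n en ne] := esmall eps eps0.
  have [Mn _] := ud n; have := pu n.
  have /d_le : M (v + u n) by rewrite -(scale1r v); exact: Mlin.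
  have := fnormD ip (x - p - v) (p - u n).
  rewrite addrACA subrK -opprD.
  lra.
apply: cmod_eq0; apply/eqP; rewrite eq_le cmod_ge0 andbT leNgt.
apply/negP => c0.
(* If [m] were not orthogonal to [x - p], a step along [m] would bring the distance below [d]: this
   [r] gives [r * N m ^+ 2 < 2], and the [+ 1] keeps the denominator positive. *)
set r := (N m ^+ 2 + 1)^-1.
have /dz : M ((r%:C%C * inner (x - p) m) *: m).
  by rewrite -(addr0 (_ *: _)); exact: Mlin.
move=> /(le_trans zd); rewrite -(@ler_pXn2r _ 2)// ?nnegrE ?fnorm_ge0//.
rewrite (fnorm_quadratic ip) -addrA lerDl.
have Nm := sqr_ge0 (N m).
have r0 : 0 < r by rewrite invr_gt0; lra.
have r1 : r * (N m ^+ 2 + 1) = 1 by rewrite mulVf//; lra.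
have : 0 < r * cmod (inner (x - p) m) ^+ 2 by rewrite mulr_gt0 ?exprn_gt0.
nra.
Qed.

End HilbertSpace.

Section BoundedOperators.
Context {R : realType} {H : completeNormedModType R[i]}.
Context (inner : {dot H for Num.conj}).
Hypothesis norm_inner : forall x : H, `|x| ^+ 2 = inner x x.
Local Notation N := (fnorm inner).
Let ip := inner_psd inner.

(** A vector outside the kernel of [f] minus its projection on the kernel is orthogonal to the
    kernel; a multiple of this difference represents [f]. *)
Lemma riesz (f : H -> R[i]) (c : R) :
  (forall a u v, f (a *: u + v) = a * f u + f v) ->
  (forall x, cmod (f x) <= c * N x) ->
  exists u, forall x, f x = inner x u.
Proof.
move=> flin fc.
have [f0|/existsNP[x0 fx0]] := pselect (forall x, f x = 0).
  by exists 0 => x; rewrite f0 form0r.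
have f0 : f 0 = 0.
  have /eqP := flin 1 0 0; rewrite scaler0 addr0 mul1r.
  by rewrite -subr_eq subrr eq_sym => /eqP.
have fB u v : f (u - v) = f u - f v.
  by rewrite addrC -scaleN1r flin mulN1r addrC.
have fZ a u : f (a *: u) = a * f u.
  by rewrite -(addr0 (_ *: _)) flin f0 addr0.
have [|a u v /= fu fv|p pM pperp] :=
  @orthogonal_projection _ _ _ norm_inner [set m | f m = 0] _ _ x0.
- exact: f0.
- by rewrite flin fu fv mulr0 addr0.
have c_gt0 : 0 < c.
  have : 0 < c * N x0 by rewrite (lt_le_trans _ (fc x0))// cmod_gt0; apply/eqP.
  have := fnorm_ge0 inner x0; rewrite le_eqVlt => /orP[/eqP<-|/pmulr_lgt0->//].
  by rewrite mulr0 ltxx.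
(* The projection is only a limit of kernel vectors; the bound [c] carries [f = 0] over to it. *)
have fp : f p = 0.
  apply: cmod_eq0; apply/eqP; rewrite eq_le cmod_ge0 andbT.
  apply/ler_addgt0Pr => e e0.
  have [m /= fm pm] := pM (e / c) (divr_gt0 e0 c_gt0).
  rewrite -(subr0 (f p)) -fm -fB (le_trans (fc _))// add0r ltW//.
  by rewrite mulrC -ltr_pdivlMr.
set n := x0 - p in pperp.
have fn : f n = f x0 by rewrite fB fp subr0.
have Nn0 : inner n n != 0.
  apply/eqP => nn0; apply: fx0; rewrite -fn.
  have : n = 0 by apply/eqP; rewrite -(dnorm_eq0 inner) nn0.
  by move=> ->.
exists ((f n / inner n n)^* *: n) => v.
(* This combination is annihilated by [f], and pairing it with [n] solves for [f v]. *)
have : inner n (f n *: v - f v *: n) = 0.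
  by apply: pperp; rewrite /= fB !fZ mulrC subrr.
rewrite (formC ip) => /(congr1 Num.conj); rewrite conjCK conjC0.
rewrite (formBl ip) !(formZl ip) (formZr ip) conjCK => /eqP.
by rewrite subr_eq0 => /eqP h; rewrite mulrAC h mulfK.
Qed.

(** The Riesz representation supplies an adjoint, so the [xget] in [adjoint] does not fall back on
    its default. *)
Lemma adjointP (T : {linear H -> H}) : continuous T ->
  adjoint_of inner T (adjoint inner T).
Proof.
move=> /(continuous_fnorm_bounded norm_inner)[c c0 Tc].
have /choice[S TS] (y : H) : exists u, forall x, inner (T x) y = inner x u.
  apply: (@riesz (fun x => inner (T x) y) (c * N y)) => [a u v|x].
    by rewrite linearP (formDl ip) (formZl ip).
  rewrite (le_trans (cauchy_schwarz ip _ _))//.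
  by rewrite mulrAC ler_wpM2r ?fnorm_ge0.
by apply: xgetPex; exists S => x y; exact: TS.
Qed.

(* Gliding hump: successive steps of length 3^-n along v n make the n-th pairing
   at least 3^-n |v n|, and the later steps add up to half of that. *)
Lemma weakly_bounded_bounded (F : set H) :
  (forall y, exists M, forall v, F v -> cmod (inner y v) <= M) ->
  exists2 C, 0 <= C & forall v, F v -> N v <= C.
Proof.
move=> wF; apply: contrapT => nF.
have [q q_gt0 q3] : exists2 q : R, 0 < q & 3 * q = 1.
  by exists 3^-1; rewrite ?invr_gt0 ?mulfV.
have q0 n : 0 < q ^+ n by rewrite exprn_gt0.
have /choice[v vF] (n : nat) : exists v, F v /\ 4 * n.+1%:R / q ^+ n < N v.
  apply: contrapT => nv; apply: nF; exists (4 * n.+1%:R / q ^+ n).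
    by rewrite divr_ge0 ?ltW// mulr_gt0 ?ltr0n.
  move=> v Fv; rewrite leNgt; apply/negP => vn; apply: nv; by exists v.
have v0 n : 0 < N (v n).
  have [_] := vF n; apply: le_lt_trans.
  by rewrite divr_ge0 ?ltW// mulr_gt0 ?ltr0n.
(* The pairings of [x + w] and [x - w] with [v n] differ by [2 * (q ^+ n * N (v n))], so one of them
   has modulus at least half of that. *)
pose step n x := let w := (q ^+ n / N (v n))%:C%C *: v n in
  if q ^+ n * N (v n) <= cmod (inner (x + w) (v n)) then x + w else x - w.
have stepN n x : N (step n x - x) = q ^+ n.
  have w : N ((q ^+ n / N (v n))%:C%C *: v n) = q ^+ n.
    rewrite (fnormZ ip) cmod_real ger0_norm ?divfK ?gt_eqF//.
    by rewrite divr_ge0 ?ltW.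
  by rewrite /step /=; case: ifP => _; rewrite addrC addKr ?fnormN.
have stepv n x : q ^+ n * N (v n) <= cmod (inner (step n x) (v n)).
  rewrite /step /=; set w := _ *: _; case: ifPn => //; rewrite -ltNge => xw.
  have e : inner w (v n) = (q ^+ n * N (v n))%:C%C.
    rewrite (formZl ip) (form_norm ip) -rmorphM /=; congr (_%:C%C).
    by field; rewrite gt_eqF.
  have : cmod (inner (x + w) (v n) - inner (x - w) (v n)) =
      2 * (q ^+ n * N (v n)).
    rewrite (formDl ip) (formBl ip) (_ : _ - _ = inner w (v n) + inner w (v n)).
      2: by ring.
    rewrite e -rmorphD.
    rewrite cmod_real ger0_norm ?addr_ge0 ?mulr_ge0 ?ltW//=.
    by rewrite mulr2n mulrDl mul1r.
  have := cmodB (inner (x + w) (v n)) (inner (x - w) (v n)); lra.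
pose u := fix u n : H := if n is n'.+1 then step n' (u n') else 0.
(* The sum of the geometric tail [q ^+ k] over [k >= n], for [q = 1/3]. *)
pose e (n : nat) : R := 3 / 2 * q ^+ n.
have eS n : e n = q ^+ n + e n.+1.
  by rewrite /e exprS; move: q3 => /(congr1 ( *%R^~ (q ^+ n))); lra.
have ue n m : (n <= m)%N -> N (u m - u n) <= e n - e m.
  elim: m => [|m IH]; first by rewrite leqn0 => /eqP->; rewrite !subrr fnorm0.
  rewrite leq_eqVlt => /orP[/eqP->|]; first by rewrite !subrr fnorm0.
  rewrite ltnS => /IH h.
  rewrite -(subrKA (u m)) (le_trans (fnormD ip _ _))//.
  have := stepN m (u m); rewrite -[step m (u m)]/(u m.+1) => ->.
  rewrite (eS m) in h; lra.
have e0 n : 0 < e n by rewrite mulr_gt0//; lra.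
have [n m nm|d d0|x xu] := @fnorm_complete _ _ _ norm_inner u e.
- by have := ue _ _ nm; have := e0 m; lra.
- have : \forall n \near \oo, q ^+ n < d / 2.
    apply: (cvgr_lt 0); last by rewrite divr_gt0.
    apply: cvg_expr; rewrite ger0_norm ?ltW//; lra.
  by case=> n _ /(_ _ (leqnn _)) /= h; exists n; rewrite /e; lra.
have [M xM] := wF x.
(* Here [M < n + 1]. The steps after the [n]-th cost at most half of the pairing, so its modulus at
   [x] is still at least [q ^+ n * N (v n) / 2 > 2 (n + 1) > M]. *)
pose n := Num.truncn `|M|; have [Fn vn] := vF n.
have := xM _ Fn; apply/negP; rewrite -ltNge.
have h1 := stepv n (u n).
have h2 : cmod (inner (x - u n.+1) (v n)) <= e n.+1 * N (v n).
  by rewrite (le_trans (cauchy_schwarz ip _ _))// ler_wpM2r ?fnorm_ge0.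
have h3 : cmod (inner (u n.+1) (v n)) <=
    cmod (inner x (v n)) + cmod (inner (x - u n.+1) (v n)).
  by rewrite (le_trans _ (cmodB _ _))// -(formBl ip) opprB addrC subrK.
have Mn : M < n.+1%:R by rewrite (le_lt_trans (ler_norm _))// truncnS_gt.
have vn' : 4 * n.+1%:R < q ^+ n * N (v n).
  by rewrite [ltRHS]mulrC -ltr_pdivrMr.
have h4 : e n.+1 = q ^+ n / 2 by have := eS n; rewrite /e; lra.
rewrite -[step n (u n)]/(u n.+1) in h1.
rewrite h4 mulrAC in h2.
have : 0 < n.+1%:R :> R by rewrite ltr0n.
lra.
Qed.

End BoundedOperators.

(** * Boundedness of A-adjointable operators *)

(** If the ratio [r] of [a 1] to [a 0] exceeded [D], doubling the index repeatedly would make [a]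
    grow at least like [r ^+ n] along powers of two, faster than the growth bound permits. *)
Lemma geometric_growth_le (R : realType) (a : nat -> R) (K D : R) :
  (forall n, 0 <= a n) -> 0 < D ->
  (forall n, a n ^+ 2 <= a 0 * a (n + n)%N) ->
  (forall n, a n ^+ 2 <= K * D ^+ (n + n)) ->
  a 1%N <= D * a 0.
Proof.
move=> a_ge0 D0 conv growth.
have [a00|a00] := eqVneq (a 0) 0.
  have := conv 1%N; rewrite a00 mul0r mulr0 => h.
  by have := a_ge0 1%N; nra.
have a0 : 0 < a 0 by rewrite lt0r a00 a_ge0.
rewrite leNgt; apply/negP => Da.
pose r := a 1%N / a 0.
have Dr : D < r by rewrite ltr_pdivlMr.
have r0 : 0 < r by exact: lt_trans Dr.
have low k : a 0 * r ^+ (2 ^ k) <= a (2 ^ k)%N.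
  elim: k => [|k IH]; first by rewrite expr1 mulrC divfK.
  rewrite expnS mul2n -addnn exprD -(ler_pM2l a0) (le_trans _ (conv _))//.
  rewrite [leLHS](_ : _ = (a 0 * r ^+ (2 ^ k)) ^+ 2); last by ring.
  rewrite lerXn2r ?nnegrE//.
  by rewrite mulr_ge0 ?exprn_ge0 ?ltW.
have K0 : 0 < K.
  have := growth 0; rewrite mulr1; apply: lt_le_trans.
  by rewrite exprn_gt0.
have s1 : D / r < 1 by rewrite ltr_pdivrMr ?mul1r.
have s0 : 0 < D / r by rewrite divr_gt0.
have : \forall n \near \oo, (D / r) ^+ n < a 0 ^+ 2 / K.
  apply: (cvgr_lt 0); last by rewrite divr_gt0 ?exprn_gt0.
  by apply: cvg_expr; rewrite ger0_norm ?ltW.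
(* The growth bound concerns the square of [a (2 ^ n)], hence the doubled exponent. *)
case=> n _ /(_ (2 ^ n + 2 ^ n)%N) /=.
rewrite ltr_pdivlMr// mulrC expr_div_n mulrA ltr_pdivrMr ?exprn_gt0//.
have nn : (n <= 2 ^ n + 2 ^ n)%N 
  by apply: (@leq_trans (2 ^ n)); [exact/ltnW/ltn_expl|exact: leq_addr].
move=> /(_ nn); apply/negP; rewrite -leNgt (le_trans _ (growth _))//.
rewrite [leLHS](_ : _ = (a 0 * r ^+ (2 ^ n)) ^+ 2); last by rewrite exprD; ring.
by rewrite lerXn2r ?nnegrE ?low// mulr_ge0 ?exprn_ge0 ?ltW.
Qed.

Section AdjointableOperators.
Context {R : realType} {H : completeNormedModType R[i]}.
Context (inner : {dot H for Num.conj}).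
Hypothesis norm_inner : forall x : H, `|x| ^+ 2 = inner x x.
Context (A : {linear H -> H}).
Hypothesis A_continuous : continuous A.
Hypothesis A_positive : positive_op inner A.
Local Notation N := (fnorm inner).
Local Notation b := (inner_wrt inner A).
Let ip := inner_psd inner.

(** Positivity equates [A] with the value chosen by [adjoint]; continuity of [A] makes that value a
    genuine adjoint. *)
Lemma positive_op_selfadjoint : adjoint_of inner A A.
Proof.
by have := adjointP norm_inner A_continuous; have [-> _] := A_positive.
Qed.
Let Asym := positive_op_selfadjoint.

Lemma inner_wrt_psd : psd_form b.
Proof.
split=> [a u v w|u v|u].
- by rewrite /inner_wrt linearP (formDl ip) (formZl ip).
- by rewrite /inner_wrt Asym (formC ip).
- by have [_ ->] := A_positive.
Qed.
Let bp := inner_wrt_psd.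

Lemma in_LA_bounded (T : {linear H -> H}) : in_LA inner A T ->
  exists2 c, 0 <= c & forall x, fnorm b (T x) <= c * fnorm b x.
Proof.
move=> [T_cont TA]; set T' := adjoint inner T in TA.
have TT' : adjoint_of inner T T' := adjointP norm_inner T_cont.
have T'T x y : inner (T' x) y = inner x (T y).
  by rewrite (formC ip) -TT' -(formC ip).
have [c c0 Tc] := continuous_fnorm_bounded norm_inner T_cont.
have T'c y : N (T' y) <= c * N y.
  have h : N (T' y) ^+ 2 <= N (T' y) * (c * N y).
    rewrite -[leLHS]ger0_norm ?sqr_ge0// -cmod_real -(form_norm ip) T'T.
    rewrite (le_trans (cauchy_schwarz ip _ _))//.
    rewrite [leRHS](_ : _ = N y * (c * N (T' y))); last by ring.
    by rewrite ler_wpM2l ?fnorm_ge0// Tc.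
  have [->|Ny] := eqVneq (N (T' y)) 0.
    by rewrite mulr_ge0 ?fnorm_ge0 ?ltW.
  by move: h; rewrite expr2 ler_pM2l// lt0r Ny fnorm_ge0.
(* The range inclusion, with preimages picked by choice; [Z] is a mere function. *)
have /choice[Z AZ] (y : H) : exists z, T' (A y) = A z.
  have [|z _ zy] := TA (T' (A y)); first by exists y.
  by exists z.
have ATZ x y : inner y (A (T x)) = (inner (A x) (Z y))^*.
  by rewrite -Asym (formC ip (A y)) TT' AZ -Asym.
(* Pairing with a fixed [y] gives at most [N (A x) * N (Z y)]: this is weak boundedness, which
   uniform boundedness turns into a bound independent of [y]. *)
have [C C0 ATC] : exists2 C, 0 <= C & forall v,
    [set A (T x) | x in [set x | N (A x) <= 1]] v -> N v <= C.
  apply: (weakly_bounded_bounded norm_inner) => y.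
  exists (N (Z y)) => _ [x /= Ax1 <-].
  rewrite ATZ cmod_conj (le_trans (cauchy_schwarz ip _ _))//.
  by rewrite ler_piMl ?fnorm_ge0.
have {}ATC x : N (A (T x)) <= C * N (A x).
  have [Ax0|Ax0] := eqVneq (N (A x)) 0.
    rewrite Ax0 mulr0 (_ : A (T x) = 0) ?fnorm0//.
    apply/eqP; rewrite -(dnorm_eq0 inner) ATZ.
    by rewrite (fnorm_eq0_form ip) ?conjC0.
  have Ax_gt0 : 0 < N (A x) by rewrite lt0r Ax0 fnorm_ge0.
  have e k : N (A (k%:C%C *: x)) = `|k| * N (A x).
    by rewrite linearZ (fnormZ ip) cmod_real.
  have : N (A (T ((N (A x))^-1%:C%C *: x))) <= C.
    apply: ATC; exists ((N (A x))^-1%:C%C *: x) => //=.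
    by rewrite e ger0_norm ?invr_ge0 ?fnorm_ge0// mulVf.
  rewrite !linearZ (fnormZ ip) cmod_real ger0_norm ?invr_ge0 ?fnorm_ge0//.
  by rewrite mulrC ler_pdivrMr.
(* [S] acts as the product of an [A]-adjoint of [T] with [T]: [A S = T^* A T] makes it symmetric for
   [b]. *)
pose S x := Z (T x).
have AS x : A (S x) = T' (A (T x)) by rewrite AZ.
have bS x y : b (S x) y = b x (S y).
  by rewrite /inner_wrt [RHS]Asym !AS T'T -TT' Asym.
(* The [+ 1] ensures [D > 0] and [D <= D ^+ 2]; the latter closes the final estimate of
   [fnorm b (T x) ^+ 2]. *)
pose D := c * C + 1.
have cC0 : 0 <= c * C by rewrite mulr_ge0// ltW.
have D0 : 0 < D by rewrite ltr_wpDl.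
have ASD x : N (A (S x)) <= D * N (A x).
  rewrite AS (le_trans (T'c _))// mulrDl mul1r.
  rewrite (@le_trans _ _ (c * C * N (A x)))//; last by rewrite lerDl fnorm_ge0.
  by rewrite -mulrA ler_pM2l.
have ASDn n x : N (A (iter n S x)) <= D ^+ n * N (A x).
  elim: n => [|n IH]; first by rewrite mul1r.
  by rewrite iterS (le_trans (ASD _))// exprS -mulrA ler_pM2l.
have bSn n x y : b (iter n S x) y = b x (iter n S y).
  by elim: n y => [//|n IH] y; rewrite iterS bS IH -iterSr.
exists D => [|x]; first exact: ltW.
pose a n := fnorm b (iter n S x).
have a2 n : a n ^+ 2 = cmod (b x (iter (n + n) S x)).
  by rewrite iterD -bSn (form_norm bp) cmod_real ger0_norm ?sqr_ge0.
(* Krein's argument, with [K = N x * N (A x)] coming from Cauchy-Schwarz for [inner] applied to [x]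
   and [A (S^2n x)]. *)
have a1 : a 1%N <= D * a 0.
  apply: (@geometric_growth_le _ _ (N x * N (A x))) => // n.
  - exact: fnorm_ge0.
  - by rewrite a2 cauchy_schwarz.
  rewrite a2 /inner_wrt Asym (le_trans (cauchy_schwarz ip _ _))//.
  by rewrite mulrAC -mulrA ler_wpM2l ?fnorm_ge0// mulrC ASDn.
have D1 : 1 <= D by rewrite lerDr.
have D_ge0 := ltW D0.
rewrite -(@ler_pXn2r _ 2)// ?nnegrE ?mulr_ge0 ?fnorm_ge0//.
have -> : fnorm b (T x) ^+ 2 = cmod (b (S x) x).
  rewrite -[LHS]ger0_norm ?sqr_ge0// -cmod_real -(form_norm bp).
  by rewrite /inner_wrt AS T'T.
rewrite (le_trans (cauchy_schwarz bp _ _))//.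
rewrite -[fnorm b (S x)]/(a 1%N) -[fnorm b x]/(a 0).
have a00 : 0 <= a 0 by exact: fnorm_ge0.
rewrite (@le_trans _ _ (D * a 0 * a 0)) ?ler_wpM2r//.
by rewrite exprMn -mulrA -expr2 ler_wpM2r ?sqr_ge0// ler_eXnr.
Qed.

End AdjointableOperators.

(** * Numerical radius and operator seminorm *)

Lemma sup_ge0 (R : realType) (E : set R) :
  (forall x, E x -> 0 <= x) -> 0 <= sup E.
Proof.
move=> E0; have [Esup|/sup_out->//] := pselect (has_sup E).
have [[r Er] Eub] := Esup.
exact: le_trans (E0 _ Er) (ub_le_sup Eub Er).
Qed.

Section FormRadius.
Context {R : realType} {V : lmodType R[i]}.
Context (b : V -> V -> R[i]) (b_psd : psd_form b).
Local Notation N := (fnorm b).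
Implicit Types (T S : V -> V) (c K : R).

(** For [b = inner_wrt inner A] this is convertible to [num_radius inner A]; the same holds on the
    direct sum. *)
Definition form_radius T : R :=
  sup [set cmod (b (T x) x) | x in [set x | N x = 1]].

Lemma cmod_form_le T c x : 0 <= c -> (forall x, N (T x) <= c * N x) ->
  cmod (b (T x) x) <= c * N x ^+ 2.
Proof.
move=> c0 Tc; rewrite (le_trans (cauchy_schwarz b_psd _ _))//.
by rewrite expr2 mulrA ler_wpM2r ?fnorm_ge0.
Qed.

Lemma form_radius_le T K : 0 <= K ->
  (forall x, N x = 1 -> cmod (b (T x) x) <= K) -> form_radius T <= K.
Proof.
move=> K0 TK; rewrite /form_radius; set E := (X in sup X).
(* When no vector has seminorm 1 the supremum is 0, which is where [0 <= K] enters. *)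
have [->|/set0P[r Er]] := eqVneq E set0; first by rewrite sup0.
by apply: ge_sup; [exists r|move=> _ [x x1 <-]; exact: TK].
Qed.

Lemma form_radius_ge0 T : 0 <= form_radius T.
Proof. by apply: sup_ge0 => _ [x _ <-]; exact: cmod_ge0. Qed.

(** Rescaling to seminorm 1 handles the vectors with [N x] nonzero, and both sides vanish at the
    others. The bound [c] makes the supremum finite. *)
Lemma form_le_radius T c : (forall a x, T (a *: x) = a *: T x) -> 0 <= c ->
  (forall x, N (T x) <= c * N x) ->
  forall x, cmod (b (T x) x) <= form_radius T * N x ^+ 2.
Proof.
move=> Thom c0 Tc x.
have [x0|x0] := eqVneq (N x) 0.
  have := cmod_form_le x c0 Tc.
  by rewrite x0 expr0n/= !mulr0.
have Nx : 0 < N x by rewrite lt0r x0 fnorm_ge0.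
set k := (N x)^-1.
have k0 : 0 < k by rewrite invr_gt0.
have -> : cmod (b (T x) x) =
    cmod (b (T (k%:C%C *: x)) (k%:C%C *: x)) * N x ^+ 2.
  rewrite Thom (formZl b_psd) (formZr b_psd) !cmodM cmod_conj cmod_real.
  rewrite gtr0_norm//.
  by rewrite /k; field.
rewrite ler_wpM2r ?sqr_ge0//; apply: ub_le_sup.
  exists c => _ [y /= y1 <-].
  by rewrite (le_trans (cmod_form_le _ c0 Tc))// y1 expr1n mulr1.
exists (k%:C%C *: x) => //=.
by rewrite (fnormZ b_psd) cmod_real gtr0_norm// mulVf.
Qed.

(* Polarization: the quadratic form of T at x + iy and x - iy differs by
   2i (b (T y) x - b (T x) y). *)
Lemma form_antisym_le (T : {linear V -> V}) K :
  (forall x, cmod (b (T x) x) <= K * N x ^+ 2) ->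
  forall x y, cmod (b (T x) y - b (T y) x) <= K * (N x ^+ 2 + N y ^+ 2).
Proof.
move=> TK x y; set z := 'i%C *: y.
have Nz : N z = N y by rewrite (fnormZ b_psd) cmod_i mul1r.
have e : b (T (x + z)) (x + z) - b (T (x - z)) (x - z) =
    (- 2 * 'i%C) * (b (T x) y - b (T y) x).
  rewrite linearD linearB.
  rewrite !(formDl b_psd, formNl b_psd, formDr b_psd, formNr b_psd).
  rewrite /z linearZ !(formZl b_psd, formZr b_psd).
  rewrite conj_i; ring.
have := cmodB (b (T (x + z)) (x + z)) (b (T (x - z)) (x - z)).
rewrite e !cmodM cmod_i mulr1 cmodN (_ : cmod 2 = 2); last first.
  by rewrite -(rmorph_nat (real_complex R)) cmod_real ger0_norm.
have := TK (x + z); have := TK (x - z).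
have := congr1 ( *%R K) (fnorm_parallelogram b_psd x z); rewrite Nz; lra.
Qed.

Lemma fnorm_le_of_form S c K : (forall a x, S (a *: x) = a *: S x) ->
  (forall x, N (S x) <= c * N x) ->
  (forall x y, cmod (b (S x) y) <= K * (N x ^+ 2 + N y ^+ 2)) ->
  forall x, N (S x) <= 2 * K * N x.
Proof.
move=> Shom Sc SK x.
have [Nx|Nx] := eqVneq (N x) 0.
  by have := Sc x; rewrite Nx !mulr0.
have [Ns|Ns] := eqVneq (N (S x)) 0.
  (* The hypothesis at the pair [(x, x)] forces [0 <= K]. *)
  have := SK x x; have := cmod_ge0 (b (S x) x).
  have : 0 < N x by rewrite lt0r Nx fnorm_ge0.
  rewrite Ns; nra.
have Nx0 : 0 < N x by rewrite lt0r Nx fnorm_ge0.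
have Ns0 : 0 < N (S x) by rewrite lt0r Ns fnorm_ge0.
(* The multiple of [S x] with the seminorm of [x]: its pairing with [S x] has modulus
   [N x * N (S x)]. *)
have := SK x ((N x / N (S x))%:C%C *: S x).
rewrite (formZr b_psd) (form_norm b_psd) cmodM cmod_conj (fnormZ b_psd).
rewrite !cmod_real.
rewrite !ger0_norm ?sqr_ge0 ?divr_ge0 ?fnorm_ge0// divfK// expr2 mulrA divfK//.
move=> h; rewrite -(ler_pM2l Nx0).
by rewrite [leRHS](_ : _ = K * (N x ^+ 2 + N x ^+ 2)); last by ring.
Qed.

End FormRadius.

Section OperatorSeminorm.
Context {R : realType} {H : completeNormedModType R[i]}.
Context (inner : {dot H for Num.conj}).
Hypothesis norm_inner : forall x : H, `|x| ^+ 2 = inner x x.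
Context (A : {linear H -> H}).
Hypothesis A_continuous : continuous A.
Hypothesis A_positive : positive_op inner A.
Local Notation b := (inner_wrt inner A).
Local Notation N := (fnorm b).
Let ip := inner_psd inner.
Let bp := inner_wrt_psd norm_inner A_continuous A_positive.

Lemma seminormE : seminorm_wrt inner A = N.
Proof. by []. Qed.

Lemma op_seminorm_ge0 (S : H -> H) : 0 <= op_seminorm inner A S.
Proof. by apply: sup_ge0 => _ [x _ <-]; rewrite divr_ge0 ?fnorm_ge0. Qed.

Lemma op_seminorm_le (S : H -> H) (c : R) : 0 <= c ->
  (forall x, N (S x) <= c * N x) -> op_seminorm inner A S <= c.
Proof.
move=> c0 Sc; rewrite /op_seminorm; set E := (X in sup X).
have Ec : ubound E c.
  move=> _ [x _ <-]; have [x0|x0] := eqVneq (N x) 0.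
    (* The inverse of 0 is 0, so a quotient with zero denominator vanishes. *)
    by rewrite seminormE x0 invr0 mulr0.
  by rewrite ler_pdivrMr ?Sc// lt0r x0 fnorm_ge0.
have [->|/set0P E0] := eqVneq E set0; first by rewrite sup0.
exact: ge_sup.
Qed.

(* The supremum only ranges over the closure of the range of A, but its
   orthogonal complement is the kernel of A, which N does not see. *)
Lemma fnorm_le_op_seminorm (S : {linear H -> H}) (c : R) :
  (forall x, N (S x) <= c * N x) ->
  forall x, N x = 1 -> N (S x) <= op_seminorm inner A S.
Proof.
move=> Sc x x1.
have [||p pA pperp] := orthogonal_projection norm_inner (M := range A) _ _ x.
- by exists 0; rewrite ?linear0.
- by move=> a _ _ [u _ <-] [v _ <-]; exists (a *: u + v); rewrite ?linearP.
(* The square of this seminorm is the pairing of [x - p] with [A (x - p)], an element of the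
   range. *)
have n0 : N (x - p) = 0.
  rewrite /fnorm /inner_wrt (positive_op_selfadjoint norm_inner A_continuous)//.
  by rewrite pperp ?sqrtr0//; exists (x - p).
have Sn0 : N (S (x - p)) = 0.
  by apply/eqP; rewrite eq_le fnorm_ge0 andbT (le_trans (Sc _))// n0 mulr0.
have Nxp : N x = N p by rewrite -(fnormD_null bp p n0) addrC subrK.
have NSxp : N (S x) = N (S p).
  by rewrite -(fnormD_null bp (S p) Sn0) -linearD addrC subrK.
apply: ub_le_sup.
  exists `|c| => _ [y _ <-]; have [y0|y0] := eqVneq (N y) 0.
    by rewrite seminormE y0 invr0 mulr0.
  rewrite ler_pdivrMr ?(le_trans (Sc _)) ?ler_wpM2r ?fnorm_ge0 ?ler_norm//.
  by rewrite lt0r y0 fnorm_ge0.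
exists p; last by rewrite seminormE -Nxp x1 divr1 -NSxp.
split; first exact: closure_fnorm pA.
apply/eqP => p0; move: Nxp; rewrite p0 x1 fnorm0// => /eqP.
by rewrite oner_eq0.
Qed.

End OperatorSeminorm.

(** * The seminorm and numerical radius on the direct sum *)

Section BlockForm.
Context {R : realType} {V : lmodType R[i]} (inner : {dot V for Num.conj}).
Context (A : V -> V) (b_psd : psd_form (inner_wrt inner A)).
Local Notation b := (inner_wrt inner A).
Local Notation O := (fun=> 0).
Local Notation bb := (inner_wrt (sum_inner inner) (block_op A O O A)).

Lemma block_formE (p q : V * V) : bb p q = b p.1 q.1 + b p.2 q.2.
Proof. by rewrite /inner_wrt /sum_inner /block_op /= addr0 add0r. Qed.

Lemma block_form_psd : psd_form bb.
Proof.
split=> [a u v w|u v|u]; rewrite !block_formE.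
- by rewrite /= !(formDl b_psd, formZl b_psd) mulrDr addrACA.
- by rewrite rmorphD /= -!(formC b_psd).
- by have [_ _ h] := b_psd; rewrite addr_ge0.
Qed.

Lemma block_fnorm (p : V * V) :
  fnorm bb p ^+ 2 = fnorm b p.1 ^+ 2 + fnorm b p.2 ^+ 2.
Proof.
apply: (@complexI R); rewrite rmorphD /= -(form_norm block_form_psd).
by rewrite block_formE !(form_norm b_psd).
Qed.

(** The left side is the modulus of the quadratic form of the block operator at [(x, y)]. The common
    bound [c] passes to the block operator, so its radius is a finite supremum. *)
Lemma block_form_le_radius (T2 T3 : {linear V -> V}) (c : R) : 0 <= c ->
  (forall x, fnorm b (T2 x) <= c * fnorm b x) ->
  (forall x, fnorm b (T3 x) <= c * fnorm b x) ->
  forall x y, cmod (b (T2 y) x + b (T3 x) y) <=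
    num_radius (sum_inner inner) (block_op A O O A) (block_op O T2 T3 O) *
    (fnorm b x ^+ 2 + fnorm b y ^+ 2).
Proof.
move=> c0 T2c T3c x y; set B := block_op O T2 T3 O.
have Bhom a p : B (a *: p) = a *: B p.
  by rewrite /B /block_op /= !linearZ !add0r !addr0.
have Bc p : fnorm bb (B p) <= c * fnorm bb p.
  rewrite -(@ler_pXn2r _ 2)// ?nnegrE ?mulr_ge0 ?fnorm_ge0//.
  rewrite exprMn !block_fnorm /= add0r addr0 mulrDr addrC -!exprMn.
  by rewrite lerD// lerXn2r ?nnegrE ?mulr_ge0 ?fnorm_ge0.
have := form_le_radius block_form_psd Bhom c0 Bc (x, y).
by rewrite block_fnorm block_formE /= add0r addr0.
Qed.

End BlockForm.

(** * The two lower bounds *)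

Theorem theorem3p2 (R : realType) (H : completeNormedModType R[i])
    (inner : {dot H for Num.conj})
    (norm_inner : forall x : H, `|x| ^+ 2 = inner x x)
    (A : {linear H -> H}) (A_continuous : continuous A)
    (A_positive : positive_op inner A)
    (T2 T3 : {linear H -> H})
    (T2_LA : in_LA inner A T2) (T3_LA : in_LA inner A T3) :
  let w := num_radius inner A in
  let nrm := op_seminorm inner A in
  let O : H -> H := fun=> 0 in
  let wT := num_radius (sum_inner inner) (block_op A O O A)
              (block_op O T2 T3 O) in
  wT >= Num.max (w T2) (w T3)
        - Num.min (nrm (T2 \+ T3) / 2) (nrm (T2 \- T3) / 2) /\
  wT >= Num.max (nrm (T2 \+ T3) / 2) (nrm (T2 \- T3) / 2)
        - Num.min (w T2) (w T3).
Proof.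
move=> w nrm O wT.
have bp := inner_wrt_psd norm_inner A_continuous A_positive.
set b := inner_wrt inner A in bp.
have [c2 c20 T2c] := in_LA_bounded norm_inner A_continuous A_positive T2_LA.
have [c3 c30 T3c] := in_LA_bounded norm_inner A_continuous A_positive T3_LA.
rewrite -/b in T2c T3c.
have wT0 : 0 <= wT by exact: form_radius_ge0.
have w0 (T : H -> H) : 0 <= w T by exact: form_radius_ge0.
have nrm0 (T : H -> H) : 0 <= nrm T by exact: op_seminorm_ge0.
have Q x y : cmod (b (T2 y) x + b (T3 x) y) <=
    wT * (fnorm b x ^+ 2 + fnorm b y ^+ 2).
  apply: (block_form_le_radius bp (c := c2 + c3)) => [|u|u].
  - exact: addr_ge0.
  - by rewrite (le_trans (T2c u))// ler_wpM2r ?fnorm_ge0// lerDl.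
  - by rewrite (le_trans (T3c u))// ler_wpM2r ?fnorm_ge0// lerDr.
have Q' x y : cmod (b (T2 y) x - b (T3 x) y) <=
    wT * (fnorm b x ^+ 2 + fnorm b y ^+ 2).
  (* The first term acquires the factor [i], the second, by conjugate-linearity, [-i]; the common
     factor has modulus 1. *)
  have := Q x ('i%C *: y).
  rewrite (fnormZ bp) cmod_i mul1r linearZ (formZl bp) (formZr bp).
  by rewrite conj_i mulNr -mulrBr cmodM cmod_i mul1r.
have w2 x : cmod (b (T2 x) x) <= w T2 * fnorm b x ^+ 2.
  by apply: (form_le_radius bp) c20 T2c x => a x; exact: linearZ.
have w3 x : cmod (b (T3 x) x) <= w T3 * fnorm b x ^+ 2.
  by apply: (form_le_radius bp) c30 T3c x => a x; exact: linearZ.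
have Sc x : fnorm b ((T2 \+ T3) x) <= (c2 + c3) * fnorm b x.
  by rewrite mulrDl (le_trans (fnormD bp _ _))//; exact: lerD (T2c x) (T3c x).
have Dc x : fnorm b ((T2 \- T3) x) <= (c2 + c3) * fnorm b x.
  by rewrite mulrDl (le_trans (fnormB bp _ _))//; exact: lerD (T2c x) (T3c x).
have Snrm x : fnorm b x = 1 -> cmod (b (T2 x) x + b (T3 x) x) <= nrm (T2 \+ T3).
  move=> x1; rewrite -(formDl bp) (le_trans (cauchy_schwarz bp _ _))//.
  rewrite x1 mulr1.
  exact: (fnorm_le_op_seminorm norm_inner A_continuous A_positive Sc).
have Dnrm x : fnorm b x = 1 -> cmod (b (T2 x) x - b (T3 x) x) <= nrm (T2 \- T3).
  move=> x1; rewrite -(formBl bp) (le_trans (cauchy_schwarz bp _ _))//.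
  rewrite x1 mulr1.
  exact: (fnorm_le_op_seminorm norm_inner A_continuous A_positive Dc).
have half (p q r : R[i]) : r + r = p + q -> cmod r <= (cmod p + cmod q) / 2.
  move=> rpq; have := cmodD p q; rewrite -rpq.
  rewrite (_ : r + r = 2 * r) ?cmodM; last by ring.
  rewrite -(rmorph_nat (real_complex R)) cmod_real ger0_norm//; lra.
(* [2 T2] and [2 T3] are the sum and the difference of [T2 + T3] and [T2 - T3]. At a unit vector one
   of these is bounded by its operator seminorm, the other by [2 wT] through [Q] or [Q'] at
   [x = y]. *)
have radius_le (T : H -> H) : (forall x, b (T x) x + b (T x) x =
      (b (T2 x) x + b (T3 x) x) + (b (T2 x) x - b (T3 x) x) \/
    b (T x) x + b (T x) x =
      (b (T2 x) x + b (T3 x) x) - (b (T2 x) x - b (T3 x) x)) ->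
    w T <= wT + nrm (T2 \+ T3) / 2 /\ w T <= wT + nrm (T2 \- T3) / 2.
  move=> Teq; have TK x : fnorm b x = 1 -> cmod (b (T x) x) <=
      (cmod (b (T2 x) x + b (T3 x) x) + cmod (b (T2 x) x - b (T3 x) x)) / 2.
    by move=> x1; case: (Teq x) => /half//; rewrite cmodN.
  split;
    (apply: form_radius_le => [|x x1]; first by rewrite addr_ge0 ?divr_ge0).
  - have := Q' x x; have := Snrm x x1; have := TK x x1.
    by rewrite x1 expr1n; lra.
  - have := Q x x; have := Dnrm x x1; have := TK x x1.
    by rewrite x1 expr1n; lra.
have [S2 D2] :
    w T2 <= wT + nrm (T2 \+ T3) / 2 /\ w T2 <= wT + nrm (T2 \- T3) / 2.
  by apply: radius_le => x; left; ring.
have [S3 D3] :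
    w T3 <= wT + nrm (T2 \+ T3) / 2 /\ w T3 <= wT + nrm (T2 \- T3) / 2.
  by apply: radius_le => x; right; ring.
have split_le (p q : R[i]) K L x y :
    cmod p <= K * (fnorm b x ^+ 2 + fnorm b y ^+ 2) ->
    cmod q <= L * (fnorm b x ^+ 2 + fnorm b y ^+ 2) ->
    cmod (p + q) <= (K + L) * (fnorm b x ^+ 2 + fnorm b y ^+ 2).
  by move=> pK qL; rewrite (le_trans (cmodD _ _))// mulrDl lerD.
have nrm_le (S : {linear H -> H}) K : 0 <= K ->
    (forall x, fnorm b (S x) <= (c2 + c3) * fnorm b x) ->
    (forall x y, cmod (b (S x) y) <= K * (fnorm b x ^+ 2 + fnorm b y ^+ 2)) ->
    nrm S / 2 <= K.
  move=> K0 Sc' SK; rewrite ler_pdivrMr// mulrC.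
  apply: op_seminorm_le; first by rewrite mulr_ge0.
  by apply: (fnorm_le_of_form bp) Sc' SK => a x; exact: linearZ.
have a2 := form_antisym_le bp w2; have a3 := form_antisym_le bp w3.
(* In this and the next three bounds, the antisymmetric part of [T2] or [T3] exchanges [x] and [y]
   in one term, giving the off-diagonal shape that [Q] and [Q'] control. *)
have US2 : nrm (T2 \+ T3) / 2 <= w T2 + wT.
  apply: nrm_le => [||x y] //; first exact: addr_ge0.
  have -> : b ((T2 \+ T3) x) y =
      (b (T2 x) y - b (T2 y) x) + (b (T2 y) x + b (T3 x) y).
    by rewrite (formDl bp); ring.
  exact: split_le (a2 x y) (Q x y).
have UD2 : nrm (T2 \- T3) / 2 <= w T2 + wT.
  apply: nrm_le => [||x y] //; first exact: addr_ge0.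
  have -> : b ((T2 \- T3) x) y =
      (b (T2 x) y - b (T2 y) x) + (b (T2 y) x - b (T3 x) y).
    by rewrite (formBl bp); ring.
  exact: split_le (a2 x y) (Q' x y).
have US3 : nrm (T2 \+ T3) / 2 <= w T3 + wT.
  apply: nrm_le => [||x y] //; first exact: addr_ge0.
  have -> : b ((T2 \+ T3) x) y =
      (b (T3 x) y - b (T3 y) x) + (b (T2 x) y + b (T3 y) x).
    by rewrite (formDl bp); ring.
  (* Here [Q] is used with [x] and [y] exchanged. *)
  by apply: split_le (a3 x y) _; rewrite [_ ^+ 2 + _]addrC.
have UD3 : nrm (T2 \- T3) / 2 <= w T3 + wT.
  apply: nrm_le => [||x y] //; first exact: addr_ge0.
  have -> : b ((T2 \- T3) x) y =
      - (b (T3 x) y - b (T3 y) x) + (b (T2 x) y - b (T3 y) x).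
    by rewrite (formBl bp); ring.
  by apply: split_le; rewrite ?cmodN ?a3// [_ ^+ 2 + _]addrC.
(* Moving the minimum to the right reduces each inequality to four bounds, one for each pair of
   entries. *)
split; rewrite lerBlDr.
- by rewrite ge_max !addr_minr !le_min S2 D2 S3 D3.
- by rewrite ge_max !addr_minr !le_min ![wT + _]addrC US2 US3 UD2 UD3.
Qed.
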